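(* There exist a family of databases $\{D_\ell\}_{\ell>0}$ and a family $\{\Sigma_{n,m}\}_{n,m>0}$ of finite sets of guarded TGDs such that for all integers $\ell,n,m>0$: $|D_\ell|=\ell$, $n=\frac{|\mathsf{sch}(\Sigma_{n,m})|}{4}-3$, $m=\frac{\mathsf{ar}(\Sigma_{n,m})}{2}-2$, $\Sigma_{n,m}\in\mathsf{CT}_{D_\ell}$ (i.e., $\mathsf{chase}(D_\ell,\Sigma_{n,m})$ is finite), and $$|\mathsf{chase}(D_\ell,\Sigma_{n,m})|\ \ge\ \ell\cdot2^{\left(2^n\cdot\left(2^{(2^m)}-1\right)\right)}.$$
   Context: **Basics.** $\mathbf{C},\mathbf{N},\mathbf{V}$ are disjoint countably infinite sets of constants, nulls and variables; their elements are terms. A schema is a finite set of predicates, each with an arity $>0$. An atom is $R(\bar t)$ with $\bar t$ a tuple of terms of length the arity of $R$; a fact is an atom with only constants. An instance is a (possibly infinite) set of atoms over constants and nulls; a database is a finite set of facts. $|\cdot|$ is cardinality. A homomorphism from a set of atoms $A$ to a set of atoms $B$ maps terms of $A$ to terms of $B$, is the identity on $\mathbf{C}$, and maps atoms of $A$ to atoms of $B$. **TGDs.** A TGD $\sigma$ is a constant-free sentence $\forall\bar x\forall\bar y(\phi(\bar x,\bar y)\to\exists\bar z\,\psi(\bar x,\bar z))$ with $\phi$ (the body) and $\psi$ (the head) non-empty conjunctions of atoms over the variables $\bar x\cup\bar y$ and $\bar x\cup\bar z$; conjunctions are identified with sets of atoms. The frontier $\mathsf{fr}(\sigma)$ is the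 set of variables $\bar x$ occurring in both body and head. A TGD is guarded if some body atom contains all variables of the body. For a finite set $\Sigma$ of TGDs, $\mathsf{sch}(\Sigma)$ is the set of predicates occurring in $\Sigma$ and $\mathsf{ar}(\Sigma)$ their maximum arity. **Semi-oblivious chase.** A trigger for $\Sigma$ on an instance $I$ is $(\sigma,h)$ with $\sigma\in\Sigma$ and $h$ a homomorphism from $\mathsf{body}(\sigma)$ to $I$. Its result $\mathsf{result}(\sigma,h)$ is $\mu(\mathsf{head}(\sigma))$, where $\mu(x)=h(x)$ if $x\in\mathsf{fr}(\sigma)$ and otherwise $\mu(x)$ is the null $\bot^x_{\sigma,h_{|\mathsf{fr}(\sigma)}}$, uniquely determined by $x$, $\sigma$ and the restriction of $h$ to $\mathsf{fr}(\sigma)$. The trigger is active if $\mathsf{result}(\sigma,h)\not\subseteq I$; applying it yields $I\cup\mathsf{result}(\sigma,h)$. A valid chase derivation of $D$ w.r.t. $\Sigma$ is a sequence of instances starting with $D$, each next one obtained by applying an active trigger, that is either finite with no active trigger on the last instance, or infinite and fair (every trigger active on some $I_i$ is not active on some later $I_j$). Its result is the union of its instances; all valid derivations have the same result, denoted $\mathsf{chase}(D,\Sigma)$. $\mathsf{CT}_D$ is the class of sets $\Sigma$ of TGDs such that $\mathsf{chase}(D,\Sigma)$ is finite. *)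

(* Defs.v *)
From HB Require Import structures.
From mathcomp Require Import all_boot all_order all_algebra.
From mathcomp Require Import finmap.
From mathcomp Require Import boolp classical_sets functions cardinality.

Set Implicit Arguments.
Unset Strict Implicit.
Unset Printing Implicit Defensive.

Local Open Scope fset_scope.

(* A predicate is a name together with its arity. *)
Definition predicate := {p : nat * nat | 0 < p.2}.
HB.instance Definition _ := Countable.on predicate.
Definition arity (R : predicate) : nat := (val R).2.

Definition const : Type := nat.
Definition var : Type := nat.
HB.instance Definition _ := Countable.on const.
HB.instance Definition _ := Countable.on var.

Definition atom (T : Type) := {R : predicate & (arity R).-tuple T}.
HB.instance Definition _ (T : countType) := Countable.on (atom T).

Definition atom_map (T U : Type) (f : T -> U) (a : atom T) : atom U :=
  Tagged (fun R => (arity R).-tuple U) (map_tuple f (tagged a)).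

Definition atom_args (T : choiceType) (a : atom T) : {fset T} :=
  [fset t | t in tval (tagged a)].

Definition args (T : countType) (A : {fset atom T}) : {fset T} :=
  \bigcup_(a <- A) atom_args a.

Definition preds (T : countType) (A : {fset atom T}) : {fset predicate} :=
  [fset tag a | a in A].

(* A TGD is determined by its body and its head: the variables of the head   *)
(* that do not occur in the body are the existentially quantified ones.      *)
Definition tgd :=
  {bh : {fset atom var} * {fset atom var} | (bh.1 != fset0) && (bh.2 != fset0)}.
HB.instance Definition _ := Countable.on tgd.
Definition body (s : tgd) : {fset atom var} := (val s).1.
Definition head (s : tgd) : {fset atom var} := (val s).2.

Definition fr (s : tgd) : {fset var} := args (body s) `&` args (head s).

Definition guarded (s : tgd) : Prop :=
  exists2 a, a \in body s & args (body s) `<=` atom_args a.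

Definition sch (S : {fset tgd}) : {fset predicate} :=
  \bigcup_(s <- S) (preds (body s) `|` preds (head s)).

Definition ar (S : {fset tgd}) : nat := \max_(R <- sch S) arity R.

(* The terms that occur in instances.  The null named after the variable x,  *)
(* the TGD s and the restriction of h to fr s is Null x s [seq h y | y <- fr s]: *)
(* given s, the restriction is determined by its values along the canonical  *)
(* enumeration of fr s.                                                      *)
Inductive term : Type :=
| Const of const
| Null of var & tgd & seq term.

Fixpoint term_encode (t : term) : GenTree.tree (const + var * tgd) :=
  match t with
  | Const c => GenTree.Leaf (inl c)
  | Null x s ts => GenTree.Node 0 (GenTree.Leaf (inr (x, s)) :: map term_encode ts)
  end.

Fixpoint term_decode (t : GenTree.tree (const + var * tgd)) : option term :=
  match t with
  | GenTree.Leaf (inl c) => Some (Const c)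
  | GenTree.Node _ (GenTree.Leaf (inr (x, s)) :: ts) =>
      Some (Null x s (pmap term_decode ts))
  | _ => None
  end.

Lemma term_encodeK : pcancel term_encode term_decode.
Proof.
rewrite /pcancel; fix IH 1 => -[c|x s ts]; first exact: erefl.
rewrite /=; congr (Some (Null _ _ _)).
by elim: ts => [|t ts IHts]; [exact: erefl | rewrite /= IH /= IHts].
Qed.

HB.instance Definition _ : isCountable term := PCanIsCountable term_encodeK.

Local Open Scope classical_set_scope.

Definition instance := set (atom term).

Definition database_instance (D : {fset atom const}) : instance :=
  [set atom_map Const a | a in [set` D]].

Definition trigger (S : {fset tgd}) (I : instance) (s : tgd) (h : var -> term) :
    Prop :=
  s \in S /\ (forall a, a \in body s -> I (atom_map h a)).

Definition trigger_subst (s : tgd) (h : var -> term) (x : var) : term :=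
  if x \in fr s then h x else Null x s [seq h y | y <- enum_fset (fr s)].

Definition result (s : tgd) (h : var -> term) : instance :=
  [set atom_map (trigger_subst s h) a | a in [set` head s]].

Definition active (S : {fset tgd}) (I : instance) (s : tgd) (h : var -> term) :
    Prop :=
  trigger S I s h /\ ~ (result s h `<=` I).

Definition chase_step (S : {fset tgd}) (I J : instance) : Prop :=
  exists s h, active S I s h /\ J = I `|` result s h.

Inductive chase_result (D : {fset atom const}) (S : {fset tgd}) : set instance :=
| FiniteDerivation (k : nat) (I : nat -> instance) of
    I 0 = database_instance D
  & (forall i, i < k -> chase_step S (I i) (I i.+1))
  & (forall s h, ~ active S (I k) s h) :
    chase_result D S (\bigcup_(i < k.+1) I i)
| InfiniteDerivation (I : nat -> instance) of
    I 0 = database_instance D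
  & (forall i, chase_step S (I i) (I i.+1))
  & (forall i s h, active S (I i) s h -> exists2 j, i < j & ~ active S (I j) s h) :
    chase_result D S (\bigcup_i I i).

(* The common result of all valid derivations, see chase_result_unique. *)
Definition chase (D : {fset atom const}) (S : {fset tgd}) : instance :=
  xget set0 (chase_result D S).

Definition CT (D : {fset atom const}) : set {fset tgd} :=
  [set S | finite_set (chase D S)].

Section Uniqueness.
Variables (D : {fset atom const}) (S : {fset tgd}).

Let closed (C : instance) :=
  database_instance D `<=` C /\
  forall s h, trigger S C s h -> result s h `<=` C.

Let step_sub (C I J : instance) :
  closed C -> I `<=` C -> chase_step S I J -> J `<=` C.
Proof.
move=> [_ clC] IC [s [h [[[sS hI] _] ->]]]; rewrite subUset; split=> //.
by apply: clC; split=> // a /hI /IC.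
Qed.

Let chase_result_min (C E : instance) :
  closed C -> chase_result D S E -> E `<=` C.
Proof.
move=> clC; case=> [k I I0 st _|I I0 st _]; apply: bigcup_sub => i /=.
  elim: i => [_|i IH ik]; first by rewrite I0; case: clC.
  by apply: step_sub (st i _) => //; apply: IH; apply: ltnW.
move=> _; elim: i => [|i IH]; first by rewrite I0; case: clC.
exact: step_sub (st i).
Qed.

Let step_mono (I : nat -> instance) k :
  (forall i, i < k -> chase_step S (I i) (I i.+1)) ->
  forall i j, i <= j -> j <= k -> I i `<=` I j.
Proof.
move=> st i; elim=> [|j IH]; first by rewrite leqn0 => /eqP -> _; exact: subset_refl.
rewrite leq_eqVlt => /predU1P[->|ij] jk; first exact: subset_refl.
apply: subset_trans (IH ij (ltnW jk)) _.
by have [s [h [_ ->]]] := st j jk; apply: subsetUl.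
Qed.

Let chase_result_closed (E : instance) : chase_result D S E -> closed E.
Proof.
case=> [k I I0 st stop|I I0 st fair].
  have EIk : \bigcup_(i < k.+1) I i = I k.
    rewrite eqEsubset; split=> [a [i /= ik]|a Ia]; last by exists k => //=.
    exact: (step_mono st).
  split; first by rewrite -I0 => a Ia; exists 0.
  by rewrite EIk => s h tr; apply: contrapT => ac; apply: (stop s h).
have mono i j : i <= j -> I i `<=` I j.
  by move=> ij; apply: (@step_mono I j).
split; first by rewrite -I0 => a Ia; exists 0.
move=> s h [sS hE].
have [i hi] : exists i, forall a, a \in body s -> I i (atom_map h a).
  suff [i hi] : exists i, forall a, a \in enum_fset (body s) -> I i (atom_map h a).
    by exists i.
  have : forall a, a \in enum_fset (body s) -> exists i, I i (atom_map h a).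
    by move=> a /hE [i _ Ii]; exists i.
  elim: (enum_fset (body s)) => [_|a l IH hl]; first by exists 0.
  have [i hi] := hl a (mem_head _ _).
  have [|j hj] := IH; first by move=> b bl; apply: hl; rewrite in_cons bl orbT.
  exists (maxn i j) => b; rewrite in_cons => /predU1P[->|/hj].
    exact: mono (leq_maxl _ _) _ hi.
  exact: mono (leq_maxr _ _) _.
have [ri|ri] := pselect (result s h `<=` I i); first by move=> a /ri; exists i.
have [|j ij nac] := fair i s h; first by split.
suff rj : result s h `<=` I j by move=> a /rj; exists j.
apply: contrapT => rj; apply: nac; split=> //; split=> // a /hi.
exact: mono (ltnW ij) _.
Qed.

Lemma chase_result_unique (C E : instance) :
  chase_result D S C -> chase_result D S E -> C = E.
Proof.
by move=> rC rE; rewrite eqEsubset; split; apply: chase_result_min => //;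
  apply: chase_result_closed.
Qed.

End Uniqueness.

(* Main.v *)
(* Each fact edge(c, d) of the database roots a binary tree of nulls of depth *)
(* about 2^K.  A node x with parent z carries a non-empty set of atoms over   *)
(* the two terms x and z only; there are K = (4n+11) * 2^(2m+2) >= n + 2^m    *)
(* shapes for these atoms, since an argument tuple x, z, t_3, ..., t_(2m+4)   *)
(* with t_i in {x, z} can be combined with any predicate but the one of the   *)
(* database.  Listing the non-empty sets of shapes by increasing cardinality  *)
(* turns them into the values of a counter, and for each value v > 0 one TGD  *)
(* says: a node whose atoms include the set number v has two children that    *)
(* carry the set number v - 1.  These TGDs are guarded because every atom in  *)
(* the body mentions both x and z.  The listing is monotone for inclusion, so *)
(* the TGDs applicable at a node of value v have a number at most v; hence    *)
(* values strictly decrease along branches, and the chase is finite.          *)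

Require Import Defs.
From mathcomp Require Import all_boot all_order all_algebra.
From mathcomp Require Import finmap.
From mathcomp Require Import boolp classical_sets functions cardinality.

Set Implicit Arguments.
Unset Strict Implicit.
Unset Printing Implicit Defensive.

Local Open Scope fset_scope.
Local Open Scope classical_set_scope.

(** The chase contains a full binary tree under each of the [l] edges of the database and is itself
    contained in a finite model. The non-empty sets of K shapes, listed by cardinality, count from
    [top] = 2^K - 2 down to 0. Each decrement creates two children, so value 0 is reached at 2^[top]
    leaves per root; a null records the path that leads to it, so the leaves carry distinct atoms
    ([counter_chase_card]). Finiteness comes from a set [model] that is closed under the TGDs
    ([model_closed]) and finite because values drop along branches ([finite_nodes]); a derivation
    inside a finite closed set must stop ([chase_sub_model]). With 4n+11 shape predicates besides
    the edge predicate, and maximum arity 2m+4, the equations for schema and arity hold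
    ([sch_counter_tgds], [max_arity_all_preds]), and K >= n + 2^m gives the bound
    ([pattern_count_bound], [depth_bound]). *)

Lemma atom_inj (T : Type) (a b : atom T) :
  tag a = tag b -> tval (tagged a) = tval (tagged b) -> a = b.
Proof.
case: a b => [R t] [R' t'] /= RR'; case: _ / RR' t' => t' /val_inj -> //.
Qed.

Lemma atom_map_comp (T U V : Type) (f : T -> U) (g : U -> V) (a : atom T) :
  atom_map g (atom_map f a) = atom_map (g \o f) a.
Proof. by apply: atom_inj => //=; rewrite -map_comp. Qed.

Lemma eq_in_atom_map (T : choiceType) (U : Type) (f g : T -> U) (a : atom T) :
  (forall t, t \in atom_args a -> f t = g t) -> atom_map f a = atom_map g a.
Proof.
move=> fg; apply: atom_inj => //=; apply/eq_in_map => t ta.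
by apply: fg; rewrite inE.
Qed.

(** * Bounding the chase by a finite model *)

Definition chase_closed (S : {fset tgd}) (C : instance) : Prop :=
  forall s h, trigger S C s h -> result s h `<=` C.

(** Active triggers are applied one after the other. Closedness of [M] keeps the derivation inside
    [M], so it is finite, and its last instance is the chase. *)
Lemma chase_sub_model (D : {fset atom const}) (S : {fset tgd}) (M : instance) :
  finite_set M -> database_instance D `<=` M -> chase_closed S M ->
  [/\ database_instance D `<=` chase D S, chase_closed S (chase D S)
    & chase D S `<=` M].
Proof.
move=> finM DM clM.
have [F FP] : {F : instance -> instance & forall I,
    (exists s h, active S I s h) -> chase_step S I (F I)}.
  apply: (@boolp.choice _ _ (fun I J => (exists s h, active S I s h) -> chase_step S I J)) => I.
  have [[s [h ac]]|nex] := pselect (exists s h, active S I s h).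
    by exists (I `|` result s h) => _; exists s, h.
  by exists I.
pose G I := if `[< exists s h, active S I s h >] then F I else I.
pose I i := iter i G (database_instance D).
have GP J : (exists s h, active S J s h) -> chase_step S J (G J).
  by move=> ex; rewrite /G asboolT //; apply: FP.
have subG J : J `<=` G J.
  rewrite /G; case: asboolP => [/FP [s [h [_ ->]]]|_]; [exact: subsetUl|exact: subset_refl].
have IM i : I i `<=` M.
  elim: i => [//|i IH]; rewrite /I iterS /G; case: asboolP => [/FP|_ //].
  move=> [s [h [[[sS hb] _] ->]]]; rewrite subUset; split=> //.
  by apply: clM; split=> // a /hb /IH.
have monoI i j : i <= j -> I i `<=` I j.
  elim: j => [|j IH]; first by rewrite leqn0 => /eqP ->.
  rewrite leq_eqVlt => /predU1P[-> //|/IH]; move/subset_trans; apply; exact: subG.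
have finI i : finite_set (I i) by exact: sub_finite_set (IM i) finM.
pose stopped k := `[< forall s h, ~ active S (I k) s h >].
have exstop : exists k, stopped k.
  apply: contrapT => nex.
  (* Without a stop, each step adds an atom, so [I i] has at least i atoms although it stays inside
     [M]. *)
  have grow i : i <= #|` fset_set (I i)|.
    elim: i => [//|i IH]; apply: leq_ltn_trans IH _; apply: fproper_ltn_card.
    have [s [h ac]] : exists s h, active S (I i) s h.
      apply: contrapT => nac; apply: nex; exists i; apply/asboolP => s h ac.
      by apply: nac; exists s, h.
    rewrite fproperE; apply/andP; split.
      by rewrite -(fset_set_sub (finI i) (finI i.+1)); exact: subG.
    apply/negP; rewrite -(fset_set_sub (finI i.+1) (finI i)) => sub.
    have [|s' [h' [[_ nsub] e]]] := GP (I i).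
      by exists s, h.
    by apply: nsub; apply: subset_trans sub; rewrite /I iterS e; apply: subsetUr.
  have := grow (#|` fset_set M|).+1; apply/negP; rewrite -ltnNge ltnS.
  apply: fsubset_leq_card; by rewrite -(fset_set_sub (finI _) finM); exact: IM.
case: (ex_minnP exstop) => k /asboolP stop mink.
have resE : chase_result D S (\bigcup_(i < k.+1) I i).
  apply: FiniteDerivation => // i ik; rewrite {2}/I iterS; apply: GP.
  apply: contrapT => nac; suff /mink : stopped i by rewrite leqNgt ik.
  by apply/asboolP => s h ac; apply: nac; exists s, h.
have EIk : \bigcup_(i < k.+1) I i = I k.
  rewrite eqEsubset; split=> [a [i /= ik]|a Ia]; last by exists k => //=.
  exact: monoI.
(* Now that some valid derivation exists, [xget] does not fall back on its default [set0], and
   uniqueness identifies its choice with the derivation built here. *)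
have rC : chase_result D S (chase D S) by exact: xgetI resE.
have EC := chase_result_unique rC resE.
rewrite EC EIk; split; [exact: (monoI 0)| |exact: IM].
move=> s h tr; apply: contrapT => ac; exact: (stop s h).
Qed.

Lemma eq_atom_map (T U : Type) (f g : T -> U) : f =1 g -> atom_map f =1 atom_map g.
Proof. by move=> fg a; apply: atom_inj => //=; apply: eq_map. Qed.

Lemma atom_map_id (T : Type) (a : atom T) : atom_map id a = a.
Proof. by apply: atom_inj => //=; rewrite map_id. Qed.

(** * Shapes of atoms, edges and the database *)

Definition sel (T : Type) (x z : T) (b : bool) : T := if b then x else z.

Lemma comp_sel (T U : Type) (f : T -> U) (x z : T) :
  f \o sel x z =1 sel (f x) (f z).
Proof. by case. Qed.

(* A shape of atoms is an atom over bool: true stands for the node and false  *)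
(* for its parent.                                                            *)
Definition is_pattern (a : atom bool) : Prop :=
  exists t, tval (tagged a) = [:: true, false & t].

(** The first two arguments expose x and z; as these differ, every further argument reveals which of
    the two it is. *)
Lemma atom_map_sel_inj (T : Type) (x z x' z' : T) (a a' : atom bool) :
  is_pattern a -> is_pattern a' -> x <> z ->
  atom_map (sel x z) a = atom_map (sel x' z') a' -> [/\ a = a', x = x' & z = z'].
Proof.
move=> [t at_] [t' at'] xz e.
have etag : tag a = tag a' by exact: (congr1 (@tag _ _) e).
have := congr1 (fun b : atom T => tval (tagged b)) e; rewrite /= at_ at' /=.
case=> ex ez; rewrite -ex -ez => et; split=> //.
apply: atom_inj => //; rewrite at_ at'; congr [:: _, _ & _].
apply: inj_map et => -[] [] //= ezx; by case: xz.
Qed.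

Definition pat (S : {fset atom bool}) (x z : var) : {fset atom var} :=
  [fset atom_map (sel x z) a | a in S].

Lemma pat_inj (x z : var) : x != z -> injective (fun S => pat S x z).
Proof.
move=> xz S S' eSS'.
have inj : injective (atom_map (sel x z)).
  apply: (can_inj (g := atom_map (fun y => y == x))) => a.
  rewrite atom_map_comp -[RHS]atom_map_id; apply: eq_atom_map => -[] /=.
    exact: eqxx.
  by rewrite eq_sym; apply/negbTE.
apply/fsetP => a; have := congr1 (fun A => atom_map (sel x z) a \in A) eSS'.
by rewrite /= /pat !mem_imfset.
Qed.

Lemma args_pat (S : {fset atom bool}) (x z : var) :
  S != fset0 -> (forall a, a \in S -> is_pattern a) -> args (pat S x z) = [fset x; z].
Proof.
move=> /fset0Pn[a0 a0S] pS; apply/fsetP => y; rewrite !inE.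
apply/bigfcupP/idP => [[_ /andP[/imfsetP[/= a aS ->] _]]|yxz].
  by rewrite inE => /mapP[[] _ ->]; rewrite eqxx ?orbT.
exists (atom_map (sel x z) a0); first by rewrite andbT; apply/imfsetP; exists a0.
rewrite inE /=; have [t ->] := pS _ a0S.
by rewrite /= !inE orbA yxz.
Qed.

Definition edge_pred : predicate := exist _ (0, 2) isT.

Definition edge (T : Type) (x z : T) : atom T :=
  Tagged (fun R => (arity R).-tuple T) ([tuple x; z] : (arity edge_pred).-tuple T).

Lemma args_edge (x z : var) : args [fset edge x z] = [fset x; z].
Proof.
apply/fsetP => y; rewrite !inE; apply/bigfcupP/idP => [[_ /andP[/fset1P -> _]]|h].
  by rewrite inE /= !inE orbF.
by exists (edge x z); [rewrite !inE eqxx|rewrite inE /= !inE orbF].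
Qed.

Lemma edge_map (T U : Type) (f : T -> U) (x z : T) :
  atom_map f (edge x z) = edge (f x) (f z).
Proof. exact: atom_inj. Qed.

Lemma edge_inj (T : Type) (x z x' z' : T) : edge x z = edge x' z' -> x = x' /\ z = z'.
Proof. by move=> /(congr1 (fun b : atom T => tval (tagged b))) [-> ->]. Qed.

Lemma fset1_neq0 (T : choiceType) (x : T) : [fset x] != fset0.
Proof. by apply/fset0Pn; exists x; rewrite inE. Qed.

(* A dummy value for mk_tgd on an empty body or head. *)
Definition edge_tgd : tgd :=
  Sub ([fset edge 0 1], [fset edge 0 1] : {fset atom var})
    (introT andP (conj (fset1_neq0 (edge 0 1)) (fset1_neq0 (edge 0 1)))).

Definition mk_tgd (B H : {fset atom var}) : tgd := insubd edge_tgd (B, H).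

Lemma mk_tgdE (B H : {fset atom var}) : B != fset0 -> H != fset0 ->
  (body (mk_tgd B H) = B) * (Defs.head (mk_tgd B H) = H).
Proof. by move=> B0 H0; rewrite /body /Defs.head /mk_tgd insubdK // -topredE /= B0. Qed.

(** All variables are in the frontier, so the result is the image of the body. *)
Lemma result_body_head (S : {fset tgd}) (I : instance) (s : tgd) (h : var -> term) :
  body s = Defs.head s -> trigger S I s h -> result s h `<=` I.
Proof.
move=> bh [_ hI] _ /= [a a_s <-].
rewrite (@eq_in_atom_map _ _ _ h) => [|y ya]; first by apply: hI; rewrite bh.
rewrite /trigger_subst /fr bh fsetIid; case: ifPn => // /negP[].
by apply/bigfcupP; exists a; rewrite ?andbT.
Qed.

(** Separates a node from its parent in [node_neq]; following the first argument suffices because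
    nulls of the tree carry a single term. *)
Fixpoint nesting (t : term) : nat :=
  if t is Null _ _ (t' :: _) then (nesting t').+1 else 0.

Definition database (l : nat) : {fset atom const} :=
  [fset edge i.+1 0 | i in iota 0 l].

Lemma card_database (l : nat) : #|` database l| = l.
Proof.
rewrite card_in_imfset /=; last by move=> i j _ _ e; have [[]] := edge_inj e.
by rewrite undup_id ?iota_uniq // size_iota.
Qed.

Lemma database_edge (l : nat) (x z : term) :
  database_instance (database l) (edge x z) ->
  exists2 i, i < l & x = Const i.+1 /\ z = Const 0.
Proof.
case=> _ /imfsetP[i /= il ->]; rewrite edge_map => e; have [<- <-] := edge_inj e.
by exists i => //; rewrite mem_iota in il.
Qed.

Lemma args_fsetU (X Y : {fset atom var}) : args (X `|` Y)%fset = (args X `|` args Y)%fset.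
Proof.
apply/fsetP => y; apply/bigfcupP/fsetUP => [[a]|].
  by rewrite andbT => /fsetUP[aX|aY] ya; [left|right]; apply/bigfcupP; exists a; rewrite ?andbT.
by case=> /bigfcupP[a] /[!andbT] aXY ya; exists a => //; rewrite andbT inE aXY ?orbT.
Qed.

(** * The counter TGDs: guardedness, frontiers, results *)

Section Counter.
(* The counter has the value v at the nodes that carry the set number v of s. *)
Variables (s : seq {fset atom bool}) (P : {fset atom var}).

Let A := nth fset0 s.
Let top := (size s).-1.

Definition init_tgd : tgd := mk_tgd [fset edge 0 1] (pat (A top) 0 1).

(** Variable 0 is the node, 1 its parent, 2 and 3 its children. Only 0 is in the frontier, so a
    child is named after its parent node alone. *)
Definition step_tgd (v : nat) : tgd :=
  mk_tgd (pat (A v) 0 1) (pat (A v.-1) 2 0 `|` pat (A v.-1) 3 0)%fset.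

(* Never active, as its head is its body: it only makes the schema as large   *)
(* as required.                                                               *)
Definition pad_tgd : tgd := mk_tgd P P.

Definition counter_tgds : {fset tgd} :=
  ([fset init_tgd; pad_tgd] `|` [fset step_tgd v | v in iota 1 top])%fset.

Hypothesis s_gt0 : 0 < size s.
Hypothesis s_uniq : uniq s.
Hypothesis s_neq0 : fset0 \notin s.
Hypothesis s_pattern : forall S a, S \in s -> a \in S -> is_pattern a /\ tag a <> edge_pred.
(** A node of value v can then trigger only TGDs with a number at most v. *)
Hypothesis s_mono : forall u v, u <= top -> v <= top -> (A u `<=` A v)%fset -> u <= v.
Hypothesis P_neq0 : P != fset0.

Let ltn_top v : v <= top -> v < size s.
Proof. by move=> vtop; rewrite -(prednK s_gt0) ltnS. Qed.

Let A_in v : v <= top -> A v \in s.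
Proof. by move=> /ltn_top vs; rewrite mem_nth. Qed.

Let A_neq0 v : v <= top -> A v != fset0.
Proof. by move=> /A_in As; apply: contraNneq s_neq0 => <-. Qed.

Let A_pattern v a : v <= top -> a \in A v -> is_pattern a.
Proof. by move=> /A_in As aA; have [] := s_pattern As aA. Qed.

Let A_tag v a : v <= top -> a \in A v -> tag a <> edge_pred.
Proof. by move=> /A_in As aA; have [] := s_pattern As aA. Qed.

Let pat_neq0 v x z : v <= top -> pat (A v) x z != fset0.
Proof.
move=> /A_neq0/fset0Pn[a aA]; apply/fset0Pn; exists (atom_map (sel x z) a).
by apply/imfsetP; exists a.
Qed.

Let initE : (body init_tgd = [fset edge 0 1]) * (Defs.head init_tgd = pat (A top) 0 1).
Proof. by apply: mk_tgdE; [exact: fset1_neq0|exact: pat_neq0]. Qed.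

Let padE : (body pad_tgd = P) * (Defs.head pad_tgd = P).
Proof. exact: mk_tgdE. Qed.

Let stepE v : v <= top -> (body (step_tgd v) = pat (A v) 0 1) *
  (Defs.head (step_tgd v) = pat (A v.-1) 2 0 `|` pat (A v.-1) 3 0)%fset.
Proof.
move=> vtop; apply: mk_tgdE; first exact: pat_neq0.
have /fset0Pn[a aA] := pat_neq0 2 0 (leq_trans (leq_pred v) vtop).
by apply/fset0Pn; exists a; rewrite inE aA.
Qed.

Let step_inj u v : u <= top -> v <= top -> step_tgd u = step_tgd v -> u = v.
Proof.
move=> utop vtop e; have := congr1 body e; rewrite !stepE // => /pat_inj => /(_ isT).
by move=> /eqP; rewrite nth_uniq ?ltn_top // => /eqP.
Qed.

Lemma counter_tgdsP r : reflect
  [\/ r = init_tgd, r = pad_tgd | exists2 v, 0 < v <= top & r = step_tgd v]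
  (r \in counter_tgds).
Proof.
apply: (iffP idP) => [/fsetUP[/fset2P[->|->]|/imfsetP[v /= vs ->]]|].
- by constructor 1.
- by constructor 2.
- by constructor 3; exists v => //; move: vs; rewrite mem_iota add1n ltnS.
case=> [->|->|[v vtop ->]]; apply/fsetUP; [left; exact: fset21|left; exact: fset22|right].
by apply/imfsetP; exists v => //=; rewrite mem_iota add1n ltnS.
Qed.

Lemma counter_guarded r :
  (forall a, a \in P -> (args P `<=` atom_args a)%fset) -> r \in counter_tgds -> guarded r.
Proof.
move=> Pg /counter_tgdsP[->|->|[v /andP[_ vtop] ->]].
- exists (edge 0 1); rewrite initE ?fset11 // args_edge; apply/fsubsetP => y.
  by rewrite !inE /= ?inE ?orbF.
- have /fset0Pn[a aP] := P_neq0; by exists a; rewrite padE //; exact: Pg.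
have /fset0Pn[a aA] := A_neq0 vtop; exists (atom_map (sel 0 1) a); rewrite stepE //.
  by apply/imfsetP; exists a.
rewrite args_pat; [|exact: A_neq0|by move=> b; exact: A_pattern].
apply/fsubsetP => y; rewrite !inE /=; have [t ->] := A_pattern vtop aA.
by rewrite /= !inE => /orP[] ->; rewrite ?orbT.
Qed.

Let fr_init : fr init_tgd = [fset 0; 1].
Proof.
rewrite /fr !initE args_edge args_pat ?fsetIid //; first exact: A_neq0.
by move=> a; exact: A_pattern.
Qed.

Let fr_step v : v <= top -> fr (step_tgd v) = [fset 0].
Proof.
move=> vtop; have v1top := leq_trans (leq_pred v) vtop.
rewrite /fr !stepE // args_fsetU !args_pat //; try exact: A_neq0;
  try by move=> a; exact: A_pattern.
by apply/fsetP => y; rewrite !inE; case: y => [|[|[|[|y]]]].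
Qed.

(** * Nodes and the finite model *)

Definition child (v : nat) (c : var) (t : term) : term := Null c (step_tgd v) [:: t].

Let result_init h b :
  result init_tgd h b <-> exists2 a, a \in A top & b = atom_map (sel (h 0) (h 1)) a.
Proof.
have substE : trigger_subst init_tgd h \o sel 0 1 =1 sel (h 0) (h 1).
  by case; rewrite /trigger_subst fr_init /= !inE.
split=> [[e /=]|[a aA ->]].
  rewrite initE => /imfsetP[a /= aA ->] <-; exists a => //.
  by rewrite atom_map_comp (eq_atom_map substE).
exists (atom_map (sel 0 1) a); first by rewrite /= initE; apply/imfsetP; exists a.
by rewrite atom_map_comp (eq_atom_map substE).
Qed.

Let result_step v h b : v <= top -> result (step_tgd v) h b <->
  exists c a, [/\ c \in [:: 2; 3], a \in A v.-1
    & b = atom_map (sel (child v c (h 0)) (h 0)) a].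
Proof.
move=> vtop; have substE c : c \in [:: 2; 3] ->
    trigger_subst (step_tgd v) h \o sel c 0 =1 sel (child v c (h 0)) (h 0).
  rewrite !inE => /orP[] /eqP ->;
  by case; rewrite /trigger_subst fr_step //= !inE -?fset_seq1.
split=> [[e /=]|[c [a [c23 aA ->]]]].
  rewrite stepE // inE => /orP[] /imfsetP[a /= aA ->] <-;
  [exists 2, a|exists 3, a]; split=> //;
  by rewrite atom_map_comp; apply: eq_atom_map; apply: substE.
exists (atom_map (sel c 0) a); last by rewrite atom_map_comp (eq_atom_map (substE _ c23)).
rewrite /= stepE // inE; move: c23; rewrite !inE => /orP[] /eqP ->; apply/orP;
  [left|right]; by apply/imfsetP; exists a.
Qed.

Let trigger_step S I v h : v <= top -> trigger S I (step_tgd v) h <->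
  step_tgd v \in S /\ forall a, a \in A v -> I (atom_map (sel (h 0) (h 1)) a).
Proof.
move=> vtop; split=> -[vS hI]; split=> // a; rewrite ?stepE // => aA.
  rewrite -(eq_atom_map (comp_sel h 0 1)) -atom_map_comp; apply: hI.
  by rewrite stepE //; apply/imfsetP; exists a.
case/imfsetP: aA => a' /= aA ->.
by rewrite atom_map_comp (eq_atom_map (comp_sel h 0 1)); exact: hI.
Qed.

(* [node l t w v]: t is a node with parent w and counter value v. *)
Inductive node (l : nat) : term -> term -> nat -> Prop :=
| Root i of i < l : node l (Const i.+1) (Const 0) top
| Child t w v u c of node l t w v & 0 < u & u <= v & c \in [:: 2; 3] :
    node l (child u c t) t u.-1.

Let node_top l t w v : node l t w v -> v <= top.
Proof.
elim=> // {}t {}w {}v u c _ vtop _ uv _.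
exact: leq_trans (leq_pred u) (leq_trans uv vtop).
Qed.

Let node_neq l t w v : node l t w v -> t <> w.
Proof.
by case=> // {}t {}w {}v u c _ _ _ _ /(congr1 nesting) /= /esym/n_Sn.
Qed.

(** A null stores its parent and the TGD that created it, and by [step_inj] this TGD determines the
    value. Hence a node never accumulates the sets of several values. *)
Let node_fun l t w v w' v' : node l t w v -> node l t w' v' -> w = w' /\ v = v'.
Proof.
case=> [i _|{}t {}w {}v u c tv u0 uv c23].
  by move e : (Const i.+1) => x nx; case: nx e.
move e : (child u c t) => x nx; case: nx e => // t' w2 v2 u' c' tv' u0' uv' c23'.
case=> _ /(step_inj _ _) e ->; split=> //; rewrite e //.
  exact: leq_trans uv (node_top tv).
exact: leq_trans uv' (node_top tv').
Qed.

(** Induction on k over the nodes of value above [top - k]: a child has a smaller value than its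
    parent, so it arises from the preceding finite set by finitely many choices. *)
Let finite_nodes l k :
  finite_set [set p : term * term * nat | node l p.1.1 p.1.2 p.2 /\ top < p.2 + k].
Proof.
elim: k => [|k IH].
  rewrite (_ : mkset _ = set0) // -subset0 => p [/node_top] /=.
  by rewrite addn0 leqNgt => /negP.
pose R := [set` [seq (Const i.+1, Const 0, top) | i <- iota 0 l]].
pose F (q : (term * term * nat) * (nat * nat)) :=
  (child q.2.1 q.2.2 q.1.1.1, q.1.1.1, q.2.1.-1).
apply: (@sub_finite_set _ _ (R `|` F @` ([set p | node l p.1.1 p.1.2 p.2 /\
  top < p.2 + k] `*` ([set` iota 0 top.+1] `*` [set` [:: 2; 3]])))); last first.
  rewrite finite_setU; split; first exact: finite_seq.
  by apply: finite_image; apply: finite_setX => //; apply: finite_setX; exact: finite_seq.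
move=> [[t w] v] /= [[i il|{}t {}w {}v u c tv u0 uv c23]] lt_top.
  by left; apply/mapP; exists i; rewrite // mem_iota.
right; exists ((t, w, v), (u, c)) => //; split=> /=; [split=> //|split=> //].
  apply: leq_trans lt_top _; rewrite addnS -addSn prednK //; exact: leq_add.
by have : u \in iota 0 top.+1 by rewrite mem_iota ltnS (leq_trans uv (node_top tv)).
Qed.

(** An over-approximation of the chase: [node] admits children for every u <= v, whether or not the
    set number u is included in the set number v. *)
Definition model (l : nat) : instance :=
  database_instance (database l) `|` [set b | exists t w v a,
    [/\ node l t w v, a \in A v & b = atom_map (sel t w) a]].

Let finite_model l : finite_set (model l).
Proof.
rewrite finite_setU; split; first by apply: finite_image; exact: finite_fset.
pose N := [set p : term * term * nat | node l p.1.1 p.1.2 p.2 /\ top < p.2 + top.+1].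
apply: (@sub_finite_set _ _ (\bigcup_(p in N)
  ((fun a => atom_map (sel p.1.1 p.1.2) a) @` [set` A p.2]))).
  move=> _ [t [w [v [a [tv aA ->]]]]]; exists (t, w, v) => /=; last by exists a.
  by split=> //; rewrite addnS ltnS leq_addl.
apply: bigcup_finite; first exact: finite_nodes.
by move=> p _; apply: finite_image; exact: finite_fset.
Qed.

Let model_edge l x z : model l (edge x z) -> exists2 i, i < l & x = Const i.+1 /\ z = Const 0.
Proof.
case=> [/database_edge //|[t [w [v [a [tv aA /(congr1 (@tag _ _)) /= e]]]]]].
by case: (A_tag (node_top tv) aA).
Qed.

Let model_pattern l x z v a : v <= top -> a \in A v -> model l (atom_map (sel x z) a) ->
  exists2 v', node l x z v' & a \in A v'.
Proof.
move=> vtop aA [[_ /imfsetP[i _ ->]] /(congr1 (@tag _ _)) /= e|].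
  by case: (A_tag vtop aA).
move=> [t [w [v' [a' [tv a'A /esym e]]]]].
have [] := atom_map_sel_inj (A_pattern (node_top tv) a'A) (A_pattern vtop aA) (node_neq tv) e.
by move=> aa' <- <-; exists v' => //; rewrite -aa'.
Qed.

Let model_closed l : chase_closed counter_tgds (model l).
Proof.
move=> r h tr; have [/counter_tgdsP rS hb] := tr.
case: rS tr hb => [->|->|[u /andP[u0 utop] ->]] tr hb.
- have := hb (edge 0 1); rewrite initE inE edge_map => /(_ (eqxx _)) /model_edge.
  move=> [i il [h0 h1]] _ /result_init[a aA ->]; right.
  by exists (h 0), (h 1), top, a; split=> //; rewrite h0 h1; exact: Root.
- by apply: (result_body_head _ tr); rewrite !padE.
have [_ {}hb] := (trigger_step _ _ _ utop).1 tr.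
have /fset0Pn[a0 a0A] := A_neq0 utop.
have [v hv _] := model_pattern utop a0A (hb _ a0A).
(* All body atoms are about the same term [h 0], so [node_fun] puts all of [A u] inside the single
   set [A v]. *)
have uv : u <= v.
  apply: s_mono (node_top hv) _ => //; apply/fsubsetP => a aA.
  have [v' hv' aA'] := model_pattern utop aA (hb _ aA).
  by have [_ ->] := node_fun hv hv'.
move=> _ /(result_step _ _ utop)[c [a [c23 aA ->]]]; right.
by exists (child u c (h 0)), (h 0), u.-1, a; split=> //; exact: Child hv _ _ _.
Qed.

Lemma counter_chase l :
  [/\ database_instance (database l) `<=` chase (database l) counter_tgds,
      chase_closed counter_tgds (chase (database l) counter_tgds)
    & finite_set (chase (database l) counter_tgds)].
Proof.
have DM : database_instance (database l) `<=` model l by exact: subsetUl.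
have [DC clC CM] := chase_sub_model (finite_model l) DM (@model_closed l).
by split=> //; exact: sub_finite_set CM (finite_model l).
Qed.

(** * The full binary tree inside the chase *)

(** [w] lists the turns from the node back to the root, latest first; the node has value
    [top - size w]. *)
Fixpoint tree_node (i : nat) (w : seq bool) : term :=
  if w is b :: w' then child (top - size w') (if b then 2 else 3) (tree_node i w')
  else Const i.+1.

Definition tree_parent (i : nat) (w : seq bool) : term :=
  if w is _ :: w' then tree_node i w' else Const 0.

Let tree_node_inj i i' w w' : tree_node i w = tree_node i' w' -> i = i' /\ w = w'.
Proof.
elim: w w' => [|b w IH] [|b' w'] //=; first by case=> ->.
case=> bb' _ /IH[-> ->]; split=> //; congr (_ :: _).
by case: b b' bb' => -[].
Qed.

Let tree_node_closed l C i w a :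
  database_instance (database l) `<=` C -> chase_closed counter_tgds C ->
  i < l -> size w <= top -> a \in A (top - size w) ->
  C (atom_map (sel (tree_node i w) (tree_parent i w)) a).
Proof.
move=> DC clC il; elim: w a => [|b w IH] a /= wtop aA.
  pose h (x : var) := if x == 0 then Const i.+1 else Const 0.
  apply: (clC init_tgd h); last first.
    by apply/result_init; exists a => //; rewrite -[top]subn0.
  split; first by apply/counter_tgdsP; constructor 1.
  move=> e; rewrite initE inE => /eqP ->; rewrite edge_map; apply: DC.
  exists (edge i.+1 0); last exact: edge_map.
  by apply/imfsetP; exists i => //=; rewrite mem_iota.
pose u := top - size w; have u0 : 0 < u by rewrite subn_gt0.
have utop : u <= top by exact: leq_subr.
pose h (x : var) := if x == 0 then tree_node i w else tree_parent i w.
apply: (clC (step_tgd u) h).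
  apply/trigger_step => //; split.
    by apply/counter_tgdsP; constructor 3; exists u; rewrite ?u0.
  by move=> a' aA'; apply: IH => //; exact: ltnW.
apply/result_step => //; exists (if b then 2 else 3), a; split=> //.
  by case: b.
by rewrite /u -subnS.
Qed.

(** One fixed shape of [A 0] is placed at every leaf; the resulting atom begins with the leaf, which
    determines root and path. *)
Lemma counter_chase_card l :
  l * 2 ^ top <= #|` fset_set (chase (database l) counter_tgds)|.
Proof.
have [DC clC finC] := counter_chase l.
have /fset0Pn[a aA] := A_neq0 (leq0n top).
pose f (p : 'I_l * top.-tuple bool) :=
  atom_map (sel (tree_node p.1 p.2) (tree_parent p.1 p.2)) a.
have f_inj : injective f.
  move=> [i w] [i' w'] /(congr1 (fun b : atom term => tval (tagged b))) /=.
  have [t ->] := A_pattern (leq0n top) aA; case=> /tree_node_inj[/val_inj -> /val_inj ->] //.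
have <- : #|` [fset f p | p in [set: 'I_l * top.-tuple bool]%SET]| = l * 2 ^ top.
  by rewrite card_imfset //= -cardE cardsT card_prod card_ord card_tuple card_bool.
apply: fsubset_leq_card; apply/fsubsetP => _ /imfsetP[[i w] _ ->].
rewrite in_fset_set // inE; by apply: tree_node_closed; rewrite //= ?size_tuple ?subnn.
Qed.

Lemma sch_counter_tgds :
  (forall S a, S \in s -> a \in S -> tag a \in preds P) -> edge_pred \in preds P ->
  sch counter_tgds = preds P.
Proof.
move=> sP eP; have patP v x z : v <= top -> (preds (pat (A v) x z) `<=` preds P)%fset.
  move=> vtop; apply/fsubsetP => _ /imfsetP[_ /= /imfsetP[a /= aA ->] ->] /=.
  exact: sP (A_in vtop) aA.
apply/eqP; rewrite eqEfsubset; apply/andP; split.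
  apply/bigfcupsP => r /counter_tgdsP rS _; rewrite fsubUset.
  case: rS => [->|->|[v /andP[_ vtop] ->]].
  - rewrite !initE patP // andbT; apply/fsubsetP => _ /imfsetP[_ /= /fset1P -> ->].
    exact: eP.
  - by rewrite !padE fsubset_refl.
  rewrite !stepE // patP //=; apply/fsubsetP => _ /imfsetP[a /= + ->].
  rewrite inE => /orP[] aA; have v1top := leq_trans (leq_pred v) vtop;
    [have /fsubsetP := patP _ 2 0 v1top|have /fsubsetP := patP _ 3 0 v1top];
    by apply; apply/imfsetP; exists a.
apply/fsubsetP => R RP; apply/bigfcupP; exists pad_tgd.
  by rewrite andbT; apply/counter_tgdsP; constructor 2.
by rewrite !padE fsetUid.
Qed.

End Counter.

(** * Listing the non-empty subsets by cardinality *)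

Definition nonempty_subsets (T : choiceType) (W : {fset T}) : seq {fset T} :=
  sort (fun S S' => #|` S| <= #|` S'|) (fpowerset W `\ fset0)%fset.

Lemma mem_nonempty_subsets (T : choiceType) (W S : {fset T}) :
  (S \in nonempty_subsets W) = (S != fset0) && (S `<=` W)%fset.
Proof. by rewrite mem_sort !inE fpowersetE. Qed.

Lemma nonempty_subsets_uniq (T : choiceType) (W : {fset T}) : uniq (nonempty_subsets W).
Proof. by rewrite sort_uniq fset_uniq. Qed.

Lemma size_nonempty_subsets (T : choiceType) (W : {fset T}) :
  size (nonempty_subsets W) = (2 ^ #|` W|).-1.
Proof.
rewrite size_sort; have := cardfsD1 fset0 (fpowerset W).
by rewrite fpowersetE fsub0set card_fpowerset => ->.
Qed.

(** If v < u, sortedness bounds the cardinality of set v by that of set u; the inclusion then forces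
    equality, against uniqueness. *)
Lemma nonempty_subsets_mono (T : choiceType) (W : {fset T}) u v :
  u < size (nonempty_subsets W) -> v < size (nonempty_subsets W) ->
  (nth fset0 (nonempty_subsets W) u `<=` nth fset0 (nonempty_subsets W) v)%fset ->
  u <= v.
Proof.
move=> us vs sub; rewrite leqNgt; apply/negP => vu.
pose leT (S S' : {fset T}) := #|` S| <= #|` S'|.
have srt : sorted leT (nonempty_subsets W) by apply: sort_sorted => S S'; exact: leq_total.
have leT_tr : transitive leT by move=> S1 S2 S3; exact: leq_trans.
have leT_refl : reflexive leT by move=> S; exact: leqnn.
have le := sorted_leq_nth leT_tr leT_refl fset0 srt v u vs us (ltnW vu).
have : nth fset0 (nonempty_subsets W) u == nth fset0 (nonempty_subsets W) v.
  by rewrite eqEfcard sub.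
by rewrite nth_uniq ?nonempty_subsets_uniq // gtn_eqF.
Qed.

(** * The concrete shapes, predicates and padding *)

(** Two fixed positions plus 2m+2 free bits; the arity also separates these predicates from
    [edge_pred]. *)
Definition pattern_pred (m k : nat) : predicate := exist _ (k, m.*2.+4) isT.

Definition pattern (q m : nat) (p : 'I_q * m.*2.+2.-tuple bool) : atom bool :=
  Tagged (fun R => (arity R).-tuple bool)
    ([tuple of [:: true, false & p.2]] : (arity (pattern_pred m p.1)).-tuple bool).

Lemma pattern_injective (q m : nat) : injective (@pattern q m).
Proof.
move=> [k w] [k' w'] e.
have /= [/val_inj ->] := congr1 (fun a => (val (tag a)).1) e.
by have /= [/val_inj ->] := congr1 (fun a : atom bool => tval (tagged a)) e.
Qed.

Definition patterns (q m : nat) : {fset atom bool} :=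
  [fset pattern p | p in [set: 'I_q * m.*2.+2.-tuple bool]%SET].

Lemma card_patterns (q m : nat) : #|` patterns q m| = q * 2 ^ m.*2.+2.
Proof.
rewrite card_imfset /=; last exact: pattern_injective.
by rewrite -cardE cardsT card_prod card_ord card_tuple card_bool.
Qed.

Definition all_preds (q m : nat) : {fset predicate} :=
  (edge_pred |` [fset pattern_pred m k | k in iota 0 q])%fset.

Lemma card_all_preds (q m : nat) : #|` all_preds q m| = q.+1.
Proof.
rewrite cardfsU1 card_in_imfset /=; last by move=> i j _ _ [].
rewrite undup_id ?iota_uniq // size_iota (_ : _ \notin _) //.
by apply/negP => /imfsetP[k _ /(congr1 arity)].
Qed.

Lemma patterns_pattern (q m : nat) a :
  a \in patterns q m -> is_pattern a /\ tag a <> edge_pred.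
Proof.
move=> /imfsetP[p _ ->]; split; first by exists p.2.
by move=> /(congr1 arity).
Qed.

(** Variable 0 is the only argument, so every atom is a guard. *)
Definition pad_atoms (q m : nat) : {fset atom var} :=
  (edge 0 0 |` pat (patterns q m) 0 0)%fset.

Lemma preds_pad_atoms (q m : nat) : preds (pad_atoms q m) = all_preds q m.
Proof.
apply/fsetP => R; apply/imfsetP/fsetUP => /= [[a]|].
  move=> /fsetUP[/fset1P -> ->|/imfsetP[b /= /imfsetP[[k w] _ ->] -> ->]].
    by left; exact: fset11.
  by right; apply/imfsetP; exists (val k); rewrite //= mem_iota /=.
case=> [/fset1P ->|/imfsetP[k /= kq ->]]; first by exists (edge 0 0); rewrite // fset1U1.
rewrite mem_iota /= add0n in kq.
exists (atom_map (sel 0 0) (pattern (Ordinal kq, [tuple of nseq m.*2.+2 true]))) => //.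
apply/fsetUP; right; apply/imfsetP.
exists (pattern (Ordinal kq, [tuple of nseq m.*2.+2 true])) => //=.
by apply/imfsetP; eexists; rewrite ?inE.
Qed.

Lemma args_pad_atoms (q m : nat) a :
  a \in pad_atoms q m -> (args (pad_atoms q m) `<=` atom_args a)%fset.
Proof.
have args0 b : b \in pad_atoms q m -> atom_args b = [fset 0].
  move=> /fsetUP[/fset1P ->|/imfsetP[c /= /imfsetP[p _ ->] ->]].
    by apply/fsetP => y; rewrite !inE /= ?inE orbF orbb.
  apply/fsetP => y; rewrite !inE /= ?inE orbA orbb.
  by apply: orb_idr => /mapP[[] _ ->].
move=> aP; rewrite args0 //; apply/bigfcupsP => b bP _.
by rewrite args0 ?fsubset_refl.
Qed.

Lemma max_arity_all_preds (q m : nat) :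
  0 < q -> \max_(R <- all_preds q m) arity R = m.*2.+4.
Proof.
move=> q0; apply/eqP; rewrite eqn_leq; apply/andP; split.
  apply/bigmax_leqP_seq => R /fsetUP[/fset1P ->|/imfsetP[k _ ->]] _ //.
apply: (@leq_bigmax_seq _ _ xpredT arity (pattern_pred m 0)) => //.
by apply/fsetUP; right; apply/imfsetP; exists 0; rewrite //= mem_iota.
Qed.

(** * Numerical bounds and conclusion *)

(** The left side is 2^(n + 2^m) - 2^n, and n > 0 makes 2^n at least 2. One predecessor discards the
    empty set, the other passes from the number of values to the largest value. *)
Lemma depth_bound (n m K : nat) : 0 < n -> n + 2 ^ m <= K ->
  2 ^ n * (2 ^ (2 ^ m) - 1) <= (2 ^ K).-1.-1.
Proof.
move=> n0 nmK; rewrite mulnBr muln1 -expnD -!subn1 -subnDA.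
apply: leq_sub; first by rewrite leq_exp2l.
by rewrite -[X in X <= _](expn1 2) leq_exp2l.
Qed.

Lemma pattern_count_bound (n m : nat) : n + 2 ^ m <= (4 * n + 11) * 2 ^ m.*2.+2.
Proof.
have m2 : 2 ^ m <= 2 ^ m.*2.+2.
  by rewrite leq_exp2l // -addnn -!addnS leq_addr.
rewrite mulnDl; apply: leq_add.
  by rewrite -[X in X <= _]muln1 leq_mul ?expn_gt0 // leq_pmull.
by rewrite (leq_trans m2) // leq_pmull.
Qed.

Theorem theorem8p4 :
  exists (D : nat -> {fset atom const}) (Sigma : nat -> nat -> {fset tgd}),
    (forall n m, 0 < n -> 0 < m ->
       forall s, s \in Sigma n m -> guarded s) /\
    (forall l n m, 0 < l -> 0 < n -> 0 < m ->
       [/\ #|` D l| = l,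
           (n%:R = #|` sch (Sigma n m)|%:R / 4%:R - 3%:R :> rat)%R,
           (m%:R = (ar (Sigma n m))%:R / 2%:R - 2%:R :> rat)%R,
           CT (D l) (Sigma n m)
         & l * 2 ^ (2 ^ n * (2 ^ (2 ^ m) - 1))
             <= #|` fset_set (chase (D l) (Sigma n m))|]).
Proof.
(* Together with [edge_pred], 4n+11 shape predicates make 4(n+3) in all. *)
pose s n m := nonempty_subsets (patterns (4 * n + 11) m).
pose P n m := pad_atoms (4 * n + 11) m.
exists database, (fun n m => counter_tgds (s n m) (P n m)).
have sizeE n m : size (s n m) = (2 ^ ((4 * n + 11) * 2 ^ m.*2.+2)).-1.
  by rewrite size_nonempty_subsets card_patterns.
have s_gt0 n m : 0 < size (s n m).
  rewrite sizeE -subn1 subn_gt0 -{1}(expn0 2) ltn_exp2l //.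
  by rewrite muln_gt0 addn_gt0 orbT expn_gt0.
have s_uniq n m : uniq (s n m) by exact: nonempty_subsets_uniq.
have s_neq0 n m : fset0 \notin s n m by rewrite mem_nonempty_subsets eqxx.
have s_sub n m S a : S \in s n m -> a \in S -> a \in patterns (4 * n + 11) m.
  by rewrite mem_nonempty_subsets => /andP[_ /fsubsetP]; apply.
have s_pattern n m S a : S \in s n m -> a \in S -> is_pattern a /\ tag a <> edge_pred.
  by move=> Ss aS; exact: patterns_pattern (s_sub _ _ _ _ Ss aS).
have s_mono n m u v : u <= (size (s n m)).-1 -> v <= (size (s n m)).-1 ->
    (nth fset0 (s n m) u `<=` nth fset0 (s n m) v)%fset -> u <= v.
  by move=> us vs; apply: nonempty_subsets_mono; rewrite -(prednK (s_gt0 n m)) ltnS.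
have P_neq0 n m : P n m != fset0.
  by apply/fset0Pn; exists (edge 0 0); exact: fset1U1.
have schE n m : sch (counter_tgds (s n m) (P n m)) = all_preds (4 * n + 11) m.
  rewrite sch_counter_tgds ?preds_pad_atoms //; last exact: fset1U1.
  move=> S a Ss aS; have /imfsetP[[k w] _ ->] := s_sub _ _ _ _ Ss aS.
  by apply/fsetUP; right; apply/imfsetP; exists (val k); rewrite //= mem_iota /=.
split=> [n m _ _ r|l n m _ n0 _].
  apply: counter_guarded => //; [exact: s_pattern|exact: args_pad_atoms].
have [_ _ fin] := counter_chase (s_gt0 n m) (s_uniq n m) (s_neq0 n m)
  (@s_pattern n m) (@s_mono n m) (P_neq0 n m) l.
have cardC := counter_chase_card (s_gt0 n m) (s_uniq n m) (s_neq0 n m)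
  (@s_pattern n m) (@s_mono n m) (P_neq0 n m) l.
split=> //.
- exact: card_database.
- rewrite schE card_all_preds -addnS (_ : 4 * n + 12 = (n + 3) * 4)%N; last first.
    by rewrite mulnDl mulnC.
  by rewrite GRing.natrM GRing.mulfK // GRing.natrD GRing.addrK.
- rewrite /ar schE max_arity_all_preds ?addn_gt0 ?orbT //.
  rewrite (_ : m.*2.+4 = (m + 2) * 2)%N; last by rewrite mulnDl muln2 !addnS addn0.
  by rewrite GRing.natrM GRing.mulfK // GRing.natrD GRing.addrK.
apply: leq_trans cardC; rewrite leq_mul2l leq_exp2l // sizeE.
by rewrite depth_bound ?orbT // pattern_count_bound.
Qed.
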